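(* For $\theta\in[0,\pi)$ let $N_\theta$ be the image of the perimeter (boundary) of the square $[-1,1]^2$ under the anticlockwise rotation by angle $\theta$ about the origin. There exists a set $A\subset\mathbb{R}^2$ of positive Lebesgue measure such that, simultaneously for all $\theta\in[0,\pi)$, the set $A+N_\theta$ has empty interior.
   Context: $X+Y=\{x+y:x\in X,y\in Y\}$. *)

(* Defs.v *)
From HB Require Import structures.
From mathcomp Require Import all_boot all_order all_algebra.
From mathcomp Require Import all_classical all_reals all_analysis.
Set Implicit Arguments. Unset Strict Implicit. Unset Printing Implicit Defensive.
Import Order.TTheory GRing.Theory Num.Theory.
Local Open Scope classical_set_scope.
Local Open Scope ring_scope.

Definition rot (R : realType) (t : R) (p : R * R) : R * R :=
  (cos t * p.1 - sin t * p.2, sin t * p.1 + cos t * p.2).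

Definition square_perimeter (R : realType) : set (R * R) :=
  [set p | Num.max `|p.1| `|p.2| = 1].

Definition Ntheta (R : realType) (t : R) : set (R * R) :=
  (@rot R t) @` (@square_perimeter R).

Definition minkowski_sum (R : realType) (X Y : set (R * R)) : set (R * R) :=
  [set z | exists x y, X x /\ Y y /\ z = (x.1 + y.1, x.2 + y.2)].

Definition leb2 (R : realType) : set (R * R) -> \bar R :=
  ((@lebesgue_measure R) \x (@lebesgue_measure R))%E.

(* Main.v *)
Require Import Defs.
From HB Require Import structures.
From mathcomp Require Import all_boot all_order all_algebra.
From mathcomp Require Import all_classical all_reals all_analysis.
From mathcomp Require Import measurable_realfun ring lra.
Import Order.TTheory GRing.Theory Num.Theory numFieldNormedType.Exports.
Local Open Scope classical_set_scope.
Local Open Scope ring_scope.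
Set Implicit Arguments. Unset Strict Implicit. Unset Printing Implicit Defensive.

(* Since N_theta is symmetric, A + N_theta misses z as soon as z + N_theta lies
   in the complement of A. It is therefore enough to find, for every point z0
   and all e, d > 0, a set of measure at most e which contains, for each theta,
   a copy of N_theta centred at distance at most d from z0: the union U of
   countably many such sets has small measure, and A is the unit square minus U.

   Moving the centre of a rotated square changes the intercepts of its four
   side lines y = a x +- sqrt(1 + a^2) and x = - a y +- sqrt(1 + a^2) by two
   numbers g(a) and g(-a), the same for both parallel sides, and every pair of
   numbers arises. So one needs a small function g on [-1, 1] for which the lines
   y = a x +- sqrt(1 + a^2) + g(a) cover little area over |x| <= 3. Write
   a = a_0 + sum_i d_i N^-i / M and put g(a) = - sum_i c_i d_i N^-i / M, where
   the c_i form a fine net of [-4, 4]. On a block of fixed a_0 the square root is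
   almost affine in a, so the line passes over x at height, up to a constant,
   sum_i (X - c_i) d_i N^-i / M for some X in [-4, 4]. If c_i is close to X, the
   digit d_i contributes almost nothing and the later digits are negligible
   compared with N^-i / M, so the N^i values of the first i digits yield N^i
   intervals of length much less than N^-i / M. Every vertical section thus has
   small measure, and Fubini concludes. *)

Import Order.TTheory GRing.Theory Num.Theory numFieldNormedType.Exports.
Local Open Scope classical_set_scope.
Local Open Scope ring_scope.

(** * Finite interval covers and Fubini estimates *)

(** Bounds the outer measure of [S] without measurability of [S]; each pair is a centre and a
    radius. *)
Definition interval_cover (R : realType) (S : set R) (C : R) : Prop :=
  exists s : seq (R * R),
    [/\ forall p, p \in s -> 0 <= p.2,
        forall y, S y -> exists2 p, p \in s & `|y - p.1| <= p.2
      & \sum_(p <- s) p.2 *+ 2 <= C].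

Lemma interval_cover_sub (R : realType) (S S' : set R) (C C' : R) :
  S `<=` S' -> C' <= C -> interval_cover S' C' -> interval_cover S C.
Proof.
move=> SS' CC' [s [s0 sS sC]]; exists s; split => //.
- by move=> y /SS'; exact: sS.
- exact: le_trans CC'.
Qed.

Lemma interval_cover_closed_ball (R : realType) (c r : R) :
  0 <= r -> interval_cover [set y | `|y - c| <= r] (r *+ 2).
Proof.
move=> r0; exists [:: (c, r)]; split.
- by move=> p; rewrite inE => /eqP ->.
- by move=> y yr; exists (c, r); rewrite ?mem_head.
- by rewrite big_seq1.
Qed.

Lemma interval_cover_setU (R : realType) (S S' : set R) (C C' : R) :
  interval_cover S C -> interval_cover S' C' ->
  interval_cover (S `|` S') (C + C').
Proof.
move=> [s [s0 sS sC]] [s' [s'0 sS' sC']]; exists (s ++ s'); split.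
- by move=> p; rewrite mem_cat => /orP[/s0|/s'0].
- move=> y [/sS|/sS'] [p ps yp]; exists p => //; rewrite mem_cat ps ?orbT //.
- by rewrite big_cat /= lerD.
Qed.

Lemma interval_cover_bigcup (R : realType) (S : nat -> set R) (n : nat) (C : R) :
  (forall i, (i < n)%N -> interval_cover (S i) C) ->
  interval_cover (\bigcup_(i < n) S i) (n%:R * C).
Proof.
elim: n => [_|n IH HS].
  exists [::]; split => //; last by rewrite big_nil mul0r.
  by move=> y [].
rewrite bigcup_mkord big_ord_recr /= -bigcup_mkord -natr1 mulrDl mul1r.
apply: interval_cover_setU; last exact: HS.
by apply: IH => i /ltnW; rewrite -ltnS; exact: HS.
Qed.

Lemma interval_cover_shift (R : realType) (S : set R) (C c : R) :
  interval_cover S C -> interval_cover [set y | S (y - c)] C.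
Proof.
move=> [s [s0 sS sC]]; exists [seq (p.1 + c, p.2) | p <- s]; split.
- by move=> _ /mapP[p /s0 ps ->].
- move=> y /sS[p ps yp]; exists (p.1 + c, p.2); first exact: map_f ps.
  by rewrite /= (_ : y - (p.1 + c) = y - c - p.1) //; ring.
- by rewrite big_map.
Qed.

Lemma lebesgue_measure_interval_cover (R : realType) (S : set R) (C : R) :
  measurable S -> interval_cover S C -> (lebesgue_measure S <= C%:E)%E.
Proof.
move=> mS [s [s0 sS sC]].
pose B (p : R * R) : set R := `[p.1 - p.2, p.1 + p.2]%classic.
have mB p : measurable (B p) by exact: measurable_itv.
have SB : S `<=` \big[setU/set0]_(p <- s) B p.
  move=> y /sS[p ps yp]; rewrite -bigcup_seq; exists p => //=.
  by rewrite /B /= in_itv /= -ler_distlC distrC.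
have mBs : measurable (\big[setU/set0]_(p <- s) B p).
  exact: bigsetU_measurable.
apply: (@le_trans _ _ (lebesgue_measure (\big[setU/set0]_(p <- s) B p))).
  by apply: le_measure; rewrite ?inE.
apply: (@le_trans _ _ (\sum_(p <- s) p.2 *+ 2)%:E); last by rewrite lee_fin.
have lB p : 0 <= p.2 -> (lebesgue_measure (B p) <= (p.2 *+ 2)%:E)%E.
  move=> p0; rewrite /B lebesgue_measure_itv /= lte_fin; case: ifP => _.
    by rewrite -EFinB lee_fin; lra.
  by rewrite lee_fin mulrn_wge0.
elim: s s0 {sS sC SB mBs} => [|p s IH] s0; first by rewrite !big_nil measure0.
rewrite !big_cons EFinD.
have mBs : measurable (\big[setU/set0]_(p <- s) B p).
  exact: bigsetU_measurable.
apply: (le_trans (measureU2 lebesgue_measure (mB p) mBs)); apply: leeD.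
  by apply: lB; apply: s0; rewrite mem_head.
by apply: IH => q qs; apply: s0; rewrite inE qs orbT.
Qed.

(** Fubini: the sections have measure at most [C] and are empty for abscissae outside [[u, v]]. *)
Lemma leb2_le_xsection (R : realType) (E : set (R * R)) (u v C : R) :
  0 <= C -> u <= v -> measurable E -> (forall p, E p -> u <= p.1 <= v) ->
  (forall x, interval_cover [set y | E (x, y)] C) ->
  (leb2 E <= (C * (v - u))%:E)%E.
Proof.
move=> C0 uv mE Euv EC; rewrite /leb2 /product_measure1.
apply: (@le_trans _ _
  (\int[lebesgue_measure]_x (C * \1_(`[u, v]%classic : set R) x)%:E)%E).
  apply: ge0_le_integral => //.
  - exact: (measurable_fun_xsection lebesgue_measure mE).
  - apply/measurable_EFinP; apply: measurable_funM => //.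
  move=> x _ /=; rewrite indicE; case: (boolP (x \in _)) => xuv.
    rewrite mulr1; apply: lebesgue_measure_interval_cover.
      exact: measurable_xsection.
    by apply: interval_cover_sub (EC x) => // y; rewrite /xsection /= inE.
  rewrite mulr0 (_ : xsection E x = set0) ?measure0 //.
  apply/seteqP; split => // y; rewrite /xsection /= inE => /Euv /= xuv'.
  by move: xuv; rewrite notin_setE /= in_itv /= xuv'.
under eq_integral do rewrite EFinM.
rewrite ge0_integralZl //; last by apply/measurable_EFinP.
have muE : lebesgue_measure (`[u, v]%classic : set R) = (v - u)%:E.
  rewrite lebesgue_measure_itv /= lte_fin.
  by case: (ltgtP u v) uv => // -> _; rewrite subrr.
by rewrite integral_indic // setIT EFinM -muE.
Qed.

Lemma leb2_le_ysection (R : realType) (E : set (R * R)) (u v C : R) :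
  0 <= C -> u <= v -> measurable E -> (forall p, E p -> u <= p.2 <= v) ->
  (forall y, interval_cover [set x | E (x, y)] C) ->
  (leb2 E <= (C * (v - u))%:E)%E.
Proof.
move=> C0 uv mE Euv EC.
pose sw (p : R * R) := (p.2, p.1).
have msw : measurable_fun setT sw by exact: measurable_fun_pair.
have mE' : measurable (sw @^-1` E).
  by rewrite -[X in measurable X]setTI; exact: msw.
suff -> : leb2 E = leb2 (sw @^-1` E).
  by apply: leb2_le_xsection => // -[x y] /Euv.
pose mu : {sigma_finite_measure set (measurableTypeR R) -> \bar R} :=
  @lebesgue_measure R.
(* By uniqueness of the product measure the order of integration may be exchanged, and [y]-sections
   of [E] are [x]-sections of its mirror image. *)
have -> : leb2 E = (mu \x^ mu)%E E.
  apply: (@product_measure_unique _ _ _ _ R mu mu (mu \x^ mu)%E) => // A B mA mB.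
  exact: product_measure2E.
rewrite /leb2 /product_measure1 /product_measure2.
by apply: eq_integral => x _ /=; rewrite /ysection /xsection.
Qed.

(** * The secant function and its linearisation *)

(* [secant a] is the secant of the inclination of a line of slope [a]: such a
   line is at distance 1 from the origin when its intercept is [secant a] or
   [- secant a]. *)
Definition secant (R : realType) (a : R) : R := Num.sqrt (1 + a ^+ 2).

Lemma secant_sqr (R : realType) (a : R) : secant a ^+ 2 = 1 + a ^+ 2.
Proof. by rewrite sqr_sqrtr // addr_ge0 // sqr_ge0. Qed.

Lemma secant_ge1 (R : realType) (a : R) : 1 <= secant a.
Proof.
have s0 : 0 <= secant a by exact: sqrtr_ge0.
by rewrite -(@ler_pXn2r _ 2) ?nnegrE // secant_sqr expr1n lerDl sqr_ge0.
Qed.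

Lemma norm_le_secant (R : realType) (a : R) : `|a| <= secant a.
Proof.
have s0 : 0 <= secant a by exact: sqrtr_ge0.
by rewrite -(@ler_pXn2r _ 2) ?nnegrE // secant_sqr real_normK ?num_real // lerDr.
Qed.

(** The squares differ by [(a - b) * (a + b)], and [|a + b|] is at most the sum of the secants. *)
Lemma secant_lipschitz (R : realType) (a b : R) :
  `|secant a - secant b| <= `|a - b|.
Proof.
have sa := secant_ge1 a; have sb := secant_ge1 b.
have s0 : 0 < secant a + secant b by lra.
rewrite -(ler_pM2r s0) -{1}(gtr0_norm s0) -normrM.
have -> : (secant a - secant b) * (secant a + secant b) = (a - b) * (a + b).
  have := secant_sqr a; have := secant_sqr b; rewrite !expr2; nra.
rewrite normrM ler_wpM2l //; apply: (le_trans (ler_normD _ _)).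
by apply: lerD; exact: norm_le_secant.
Qed.

(** The error is [secant a * secant b - (1 + a * b)] divided by [secant a >= 1]. This numerator
    times its conjugate is [(b - a) ^+ 2], and the conjugate is at least 1 because [a * b >= -1]. *)
Lemma secant_tangent (R : realType) (a b : R) : `|a| <= 1 -> `|b| <= 1 ->
  `|secant b - secant a - a / secant a * (b - a)| <= (b - a) ^+ 2.
Proof.
move=> a1 b1; have sa := secant_ge1 a; have sb := secant_ge1 b.
have sa0 : 0 < secant a by lra.
have -> : secant b - secant a - a / secant a * (b - a) =
    (secant a * secant b - (1 + a * b)) / secant a.
  have := secant_sqr a; rewrite expr2 => H.
  apply: (mulIf (lt0r_neq0 sa0)); rewrite divfK ?lt0r_neq0 //.
  have qs : a / secant a * secant a = a by rewrite divfK ?lt0r_neq0.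
  have : a / secant a * (b - a) * secant a = a * (b - a) by rewrite mulrAC qs.
  nra.
have ab : -1 <= a * b.
  rewrite -lerN2 opprK; apply: le_trans (ler_norm _) _.
  by rewrite normrN normrM; apply: mulr_ile1.
have s1 : 1 <= secant a * secant b by nra.
have K : (secant a * secant b - (1 + a * b)) *
         (secant a * secant b + (1 + a * b)) = (b - a) ^+ 2.
  rewrite -subr_sqr exprMn !secant_sqr; ring.
have q0 : 0 <= (b - a) ^+ 2 by exact: sqr_ge0.
have d0 : 0 <= secant a * secant b - (1 + a * b) by nra.
have sa1 : 0 <= secant a by exact: ltW.
rewrite ger0_norm ?divr_ge0 // ler_pdivrMr //; nra.
Qed.

(** Nonnegative increments telescope. This bounds both the size of [digit_shift] and the
    contribution of late digits. *)
Lemma weighted_increments (R : realType) (T w : nat -> R) (B : R) (i k : nat) :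
  (i <= k)%N -> (forall j, (i <= j < k)%N -> T j <= T j.+1) ->
  (forall j, (i <= j < k)%N -> `|w j| <= B) ->
  `|\sum_(i <= j < k) w j * (T j.+1 - T j)| <= B * (T k - T i).
Proof.
move=> ik Tmono wB; rewrite -(telescope_sumr T ik) big_distrr /=.
apply: (le_trans (ler_norm_sum _ _ _)).
apply: ler_sum_nat => j jik; rewrite normrM.
have T0 : 0 <= T j.+1 - T j by rewrite subr_ge0 Tmono.
by rewrite (ger0_norm T0) ler_wpM2r // wB.
Qed.

(** * Digit compression *)

Section digits.
Variables (R : realType) (p M : nat).
Let N := (8 * p)%N.
Let k := N.+1.
Let q i := (N ^ (k - i))%N.
Let D := (M * N ^ k)%N.
Hypotheses (p0 : (0 < p)%N) (pM : (p * N ^ k <= M)%N).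

Let N0 : (0 < N)%N. Proof. by rewrite muln_gt0. Qed.
Let q0 i : (0 < q i)%N. Proof. by rewrite expn_gt0 N0. Qed.
Let M0 : (0 < M)%N.
Proof. by apply: leq_trans pM; rewrite muln_gt0 p0 expn_gt0 N0. Qed.
Let D0 : (0 < D)%N. Proof. by rewrite muln_gt0 M0 expn_gt0 N0. Qed.

(* A leaf [n <= 2 * D] stands for the slope [n / D - 1] of [-1, 1], written with
   one digit of mesh [1 / M] followed by [k] digits in base [N];
   [digit_trunc i n] keeps the first [i] of the latter. *)
Definition digit_trunc (i n : nat) : R := (n %/ q i * q i)%:R / D%:R - 1.
Local Notation T := digit_trunc.

(* For [i < k] the weights form a net of [-4, 4] of mesh [1 / p], so every
   abscissa in [-4, 4] is nearly annihilated by some level. *)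
Definition digit_weight (i : nat) : R := i%:R / p%:R - 4.
Local Notation c := digit_weight.

Definition digit_shift (n : nat) : R :=
  - \sum_(0 <= j < k) c j * (T j.+1 n - T j n).

Lemma digit_trunc_le (i n : nat) : (i < k)%N -> T i n <= T i.+1 n.
Proof.
move=> ik; rewrite lerD2r ler_wpM2r ?invr_ge0 ?ler0n // ler_nat.
have -> : q i = (N * q i.+1)%N by rewrite /q -expnS subnSK.
rewrite mulnA leq_mul2r leq_divRL //; apply/orP; right.
by rewrite -mulnA leq_divM.
Qed.

Lemma digit_trunc_last (n : nat) : T k n = n%:R / D%:R - 1.
Proof. by rewrite /T /q subnn expn0 muln1 divn1. Qed.

(** The discarded digits form the remainder [n %% q i < q i], and [D = M * N ^ i * q i]. *)
Lemma digit_trunc_gap (i n : nat) : (i <= k)%N ->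
  0 <= T k n - T i n <= (M%:R * N%:R ^+ i)^-1.
Proof.
move=> ik; rewrite digit_trunc_last /T opprB addrA subrK -mulrBl.
rewrite -natrB ?leq_divM // {1 3}(divn_eq n (q i)) addKn.
rewrite divr_ge0 //=.
have Dq : D%:R = M%:R * N%:R ^+ i * (q i)%:R :> R.
  by rewrite -natrX -!natrM /D /q -mulnA -expnD subnKC.
have qr0 : 0 < (q i)%:R :> R by rewrite ltr0n.
have W0 : 0 < M%:R * N%:R ^+ i :> R by rewrite mulr_gt0 ?exprn_gt0 ?ltr0n.
rewrite Dq invfM mulrCA ler_piMr ?invr_ge0 ?(ltW W0) //.
by rewrite ler_pdivrMr // mul1r ler_nat ltnW // ltn_mod.
Qed.

(** Quantities built from the first [i] digits thus take one value per node, which is what limits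
    the number of covering intervals. *)
Lemma digit_trunc_node (j i n : nat) : (j <= i)%N -> (i <= k)%N ->
  T j (n %/ q i * q i) = T j n.
Proof.
move=> ji ik; rewrite /T; congr (_ %:R / _ - _); congr (_ * _)%N.
have -> : q j = (q i * N ^ (i - j))%N.
  by rewrite /q -expnD addnBA // subnK.
by rewrite !divnMA mulnK.
Qed.

Lemma digit_trunc_norm (i n : nat) : (n <= 2 * D)%N -> `|T i n| <= 1.
Proof.
move=> nD; rewrite ler_norml /T.
have Dr : 0 < D%:R :> R by rewrite ltr0n.
have h0 : 0 <= (n %/ q i * q i)%:R / D%:R :> R by rewrite divr_ge0.
have h2 : (n %/ q i * q i)%:R / D%:R <= 2 :> R.
  rewrite ler_pdivrMr // -natrM ler_nat.
  by apply: leq_trans nD; rewrite leq_divM.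
by apply/andP; split; lra.
Qed.

Lemma digit_weight_norm (i : nat) : (i < k)%N -> `|c i| <= 4.
Proof.
move=> ik; rewrite ler_norml /c.
have pr : 0 < p%:R :> R by rewrite ltr0n.
have h0 : 0 <= i%:R / p%:R :> R by rewrite divr_ge0.
have h8 : i%:R / p%:R <= 8 :> R by rewrite ler_pdivrMr // -natrM ler_nat.
by apply/andP; split; lra.
Qed.

Lemma digit_shift_norm (n : nat) : `|digit_shift n| <= 4 / M%:R.
Proof.
rewrite normrN; apply: le_trans (@weighted_increments _ (T ^~ n) c 4 0 k _ _ _) _ => //.
- by move=> j /andP[_]; exact: digit_trunc_le.
- by move=> j /andP[_]; exact: digit_weight_norm.
rewrite ler_wpM2l //; have /andP[_] := @digit_trunc_gap 0 n isT.
by rewrite expr0 mulr1.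
Qed.

Definition leaf_line (b : bool) (x : R) (n : nat) : R :=
  T k n * x + (-1) ^+ b * secant (T k n) + digit_shift n.

(* Replacing [secant] by its tangent at the first digit turns the tangent line
   of slope [a], up to an error of size [1 / M ^ 2], into an affine function of
   [a] whose slope is this corrected abscissa. *)
Definition node_abscissa (b : bool) (x : R) (n : nat) : R :=
  x + (-1) ^+ b * (T 0 n / secant (T 0 n)).
Local Notation X := node_abscissa.

(** Height of the leaf line once [secant] is linearised at [T 0 n] and the increments of index
    [j >= i] are dropped. *)
Definition node_center (b : bool) (x : R) (i n : nat) : R :=
  T 0 n * x + (-1) ^+ b * secant (T 0 n)
  + \sum_(0 <= j < i) (X b x n - c j) * (T j.+1 n - T j n).

Lemma node_abscissa_norm (b : bool) (x : R) (n : nat) :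
  `|x| <= 3 -> `|X b x n| <= 4.
Proof.
move=> x3; apply: (le_trans (ler_normD _ _)).
rewrite normrMsign normrM normfV.
have s1 := secant_ge1 (T 0 n).
have s0 : 0 < secant (T 0 n) by lra.
have : `|T 0 n| / `|secant (T 0 n)| <= 1.
  by rewrite (gtr0_norm s0) ler_pdivrMr // mul1r norm_le_secant.
lra.
Qed.

(** Three errors, each at most [1 / (p * M * N ^ i)]: digit [i] has a factor at most [1 / p]; later
    digits have factors at most 8 on a total increment at most [1 / (M * N ^ i.+1)], with
    [N = 8 * p]; the tangent error is at most [1 / M ^ 2], absorbed by [pM]. *)
Lemma leaf_line_near_center (b : bool) (x : R) (i n : nat) :
  (n <= 2 * D)%N -> `|x| <= 3 -> (i < k)%N -> `|X b x n - c i| <= p%:R^-1 ->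
  `|leaf_line b x n - node_center b x i n| <= 3 / (p%:R * (M%:R * N%:R ^+ i)).
Proof.
move=> nD x3 ik Xi.
pose w j := X b x n - c j.
pose err := secant (T k n) - secant (T 0 n)
            - T 0 n / secant (T 0 n) * (T k n - T 0 n).
have -> : leaf_line b x n - node_center b x i n =
    w i * (T i.+1 n - T i n)
    + \sum_(i.+1 <= j < k) w j * (T j.+1 n - T j n) + (-1) ^+ b * err.
  have tele : \sum_(0 <= j < k) (T j.+1 n - T j n) = T k n - T 0 n.
    by rewrite telescope_sumr.
  have split : \sum_(0 <= j < k) w j * (T j.+1 n - T j n) =
      \sum_(0 <= j < i) w j * (T j.+1 n - T j n) + (w i * (T i.+1 n - T i n)
      + \sum_(i.+1 <= j < k) w j * (T j.+1 n - T j n)).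
    by rewrite (@big_cat_nat _ _ _ i) //= 1?ltnW // (@big_ltn _ _ _ i).
  have full : \sum_(0 <= j < k) w j * (T j.+1 n - T j n) =
      X b x n * (T k n - T 0 n) + digit_shift n.
    rewrite -tele big_distrr /= /digit_shift -sumrB.
    by apply: eq_bigr => j _; rewrite mulrBl.
  move: split; rewrite full /leaf_line /node_center /err /X /w => H.
  lra.
have pr : 0 < p%:R :> R by rewrite ltr0n.
have Mr : 0 < M%:R :> R by rewrite ltr0n.
have Nr : 0 < N%:R :> R by rewrite ltr0n.
have Ni : 0 < N%:R ^+ i :> R by rewrite exprn_gt0.
pose W : R := (p%:R * (M%:R * N%:R ^+ i))^-1.
have b1 : `|w i * (T i.+1 n - T i n)| <= W.
  have d0 : 0 <= T i.+1 n - T i n by rewrite subr_ge0 digit_trunc_le.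
  rewrite normrM (ger0_norm d0) /W invfM ler_pM //.
  have /andP[g1 _] := @digit_trunc_gap i.+1 n ik.
  by have /andP[_ g2] := @digit_trunc_gap i n (ltnW ik); lra.
have b2 : `|\sum_(i.+1 <= j < k) w j * (T j.+1 n - T j n)| <= W.
  apply: le_trans (@weighted_increments _ (T ^~ n) w 8 i.+1 k _ _ _) _ => //.
  - by move=> j /andP[_]; exact: digit_trunc_le.
  - move=> j /andP[_ /digit_weight_norm cj].
    have Xn := node_abscissa_norm b n x3.
    by apply: (le_trans (ler_normB _ _)); lra.
  have /andP[_ g2] := @digit_trunc_gap i.+1 n ik.
  apply: (@le_trans _ _ (8 * (M%:R * N%:R ^+ i.+1)^-1)).
    by rewrite ler_wpM2l.
  have NE : N%:R = 8 * p%:R :> R by rewrite natrM.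
  have cancel8 (m P s : R) : 0 < m -> 0 < P -> 0 < s ->
      8 * (m * (P * (8 * s)))^-1 = (s * (m * P))^-1.
    by move=> m0 P0 s0; field; rewrite !lt0r_neq0.
  by rewrite exprSr [X in _ * (_ * X)]NE cancel8.
have b3 : `|(-1) ^+ b * err| <= W.
  rewrite normrMsign; apply: le_trans (secant_tangent _ _) _;
    rewrite ?digit_trunc_norm //.
  have /andP[g1 g2] := @digit_trunc_gap 0 n isT.
  rewrite expr0 mulr1 in g2.
  apply: (@le_trans _ _ (M%:R^-1 * M%:R^-1)); first by rewrite expr2 ler_pM.
  rewrite /W !invfM mulrCA ler_wpM2l ?invr_ge0 ?(ltW Mr) //.
  rewrite -invfM lef_pV2 ?posrE ?mulr_gt0 // -natrX -natrM ler_nat.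
  apply: leq_trans pM; rewrite leq_mul2l leq_pexp2l ?orbT // ltnW //.
rewrite -[3 / _]/(3 * W).
apply: (le_trans (ler_normD _ _)); have := ler_normD (w i * (T i.+1 n - T i n))
  (\sum_(i.+1 <= j < k) w j * (T j.+1 n - T j n)).
lra.
Qed.

(* The level of the covering intervals depends on the first digit: it is the
   level whose weight is nearest to the corrected abscissa. *)
Lemma leaf_lines_slice_cover (b : bool) (x : R) : `|x| <= 3 ->
  interval_cover
    [set y | exists2 n, (n <= 2 * D)%N & `|y - leaf_line b x n| <= 4 / D%:R]
    (24 / p%:R).
Proof.
have w4 (w : R) : w + 3 * w <= 4 * w by lra.
move=> x3.
have pr : 0 < p%:R :> R by rewrite ltr0n.
have Mr : 0 < M%:R :> R by rewrite ltr0n.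
have Nr : 0 < N%:R :> R by rewrite ltr0n.
(* Rounding down gives [c (lev j) <= X < c (lev j) + 1 / p]. The value [X = 4] needs level [N],
   whence [k = N.+1] levels. *)
pose lev j := Num.truncn ((X b x (j * q 0) + 4) * p%:R).
have lev_itv j : (lev j)%:R <= (X b x (j * q 0) + 4) * p%:R < (lev j).+1%:R.
  apply: truncn_itv; rewrite mulr_ge0 ?(ltW pr) //.
  by have := node_abscissa_norm b (j * q 0) x3; rewrite ler_norml; lra.
have levk j : (lev j < k)%N.
  rewrite ltnS -(ler_nat R); have /andP[+ _] := lev_itv j => /le_trans; apply.
  rewrite natrM ler_wpM2r ?(ltW pr) //.
  by have := node_abscissa_norm b (j * q 0) x3; rewrite ler_norml; lra.
(* Of the 4, three parts are the distance from leaf line to node centre, and one absorbs the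
   thickness [4 / D]. *)
pose rad j : R := 4 / (p%:R * (M%:R * N%:R ^+ lev j)).
pose ball j m := [set y | `|y - node_center b x (lev j)
  ((j * N ^ lev j + m) * q (lev j))| <= rad j].
(* Every block costs [8 / (p * M)] whatever its level: [N ^ lev j] intervals of length
   [8 / (p * M * N ^ lev j)]. The extra block beyond [2 * M] holds the slope 1. *)
have cov : interval_cover
    (\bigcup_(j < (2 * M).+1) \bigcup_(m < (N ^ lev j)%N) ball j m)
    ((2 * M).+1%:R * (8 / (p%:R * M%:R))).
  apply: interval_cover_bigcup => j _.
  have -> : 8 / (p%:R * M%:R) = (N ^ lev j)%:R * (rad j *+ 2).
    rewrite /rad natrX; field.
    by rewrite !lt0r_neq0 // exprn_gt0.
  apply: interval_cover_bigcup => m _; apply: interval_cover_closed_ball.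
  by rewrite divr_ge0 // !mulr_ge0 // exprn_ge0.
apply: interval_cover_sub cov; last first.
  apply: (@le_trans _ _ (3 * M%:R * (8 / (p%:R * M%:R)))).
    rewrite ler_wpM2r ?divr_ge0 ?mulr_ge0 //.
    by rewrite -natrM ler_nat -add1n (mulnDl 1 2) leq_add2r mul1n.
  by rewrite le_eqVlt; apply/orP; left; apply/eqP; field; rewrite !lt0r_neq0.
move=> y [n nD yn].
(* The first digit of [n], the level of its block, and the number written by its next [i] digits. *)
pose j := (n %/ q 0)%N; pose i := lev j; pose m := ((n %/ q i) %% N ^ i)%N.
have ik : (i < k)%N by exact: levk.
have jE : (n %/ q i %/ N ^ i)%N = j.
  by rewrite -divnMA /q -expnD subnK ?subn0 // ltnW.
exists j; rewrite /=.
  by rewrite ltnS (leq_trans (leq_div2r _ nD)) // /D /q subn0 mulnA mulnK // expn_gt0 N0.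
exists m; first by rewrite /= ltn_mod expn_gt0 N0.
rewrite /ball /= -/i -jE -divn_eq.
have XE : X b x (j * q 0) = X b x n by rewrite /X /j digit_trunc_node.
have -> : node_center b x i (n %/ q i * q i) = node_center b x i n.
  rewrite /node_center /X !digit_trunc_node // 1?ltnW //; congr (_ + _).
  rewrite big_nat [RHS]big_nat; apply: eq_bigr => l /andP[_ li].
  by rewrite !digit_trunc_node // 1?ltnW // ltnW.
have Xi : `|X b x n - c i| <= p%:R^-1.
  have := lev_itv j; rewrite XE -/i -natr1 => /andP[h1 h2].
  have -> : X b x n - c i = ((X b x n + 4) * p%:R - i%:R) / p%:R.
    by rewrite /c; field; rewrite lt0r_neq0.
  rewrite normrM (gtr0_norm (_ : 0 < p%:R^-1)) ?invr_gt0 //.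
  by rewrite ler_piMl ?invr_ge0 ?(ltW pr) // ler_norml; lra.
have near := leaf_line_near_center nD x3 ik Xi.
have DW : 4 / D%:R <= (p%:R * (M%:R * N%:R ^+ i))^-1 :> R.
  have Wr : 0 < p%:R * (M%:R * N%:R ^+ i) :> R by rewrite !mulr_gt0 ?exprn_gt0.
  rewrite ler_pdivrMr ?ltr0n // mulrC ler_pdivlMr // -natrX -!natrM ler_nat.
  apply: (@leq_trans (M * N ^ i.+1)); last by rewrite leq_mul2l leq_pexp2l ?orbT.
  rewrite expnSr; move: (N ^ i)%N => P.
  rewrite (_ : 4 * (p * (M * P)) = 4 * (M * P * p))%N; last by ring.
  rewrite (_ : M * (P * N) = 8 * (M * P * p))%N; last by rewrite /N; ring.
  by rewrite leq_mul2r orbT.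
rewrite /rad -/i (_ : y - _ = (y - leaf_line b x n) +
  (leaf_line b x n - node_center b x i n)); last by ring.
apply: (le_trans (ler_normD _ _)).
by apply: (le_trans (lerD (le_trans yn DW) near)); rewrite jE; exact: w4.
Qed.

End digits.

(** * A small set containing shifted tangent lines of every slope *)

Lemma measurable_strip (R : realType) (a b r : R) :
  measurable [set p : R * R | `|p.2 - (a * p.1 + b)| <= r].
Proof.
have mf : measurable_fun setT (fun p : R * R => `|p.2 - (a * p.1 + b)|).
  apply: measurableT_comp => //; apply: measurable_funB => //.
  apply: measurable_funD => //; apply: measurable_funM => //.
have -> : [set p : R * R | `|p.2 - (a * p.1 + b)| <= r] =
    setT `&` (fun p : R * R => `|p.2 - (a * p.1 + b)|) @^-1` `]-oo, r].
  by rewrite setTI; apply/seteqP; split => p /=; rewrite in_itv.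
by apply: mf => //; exact: measurable_itv.
Qed.

(** Rounding [a] down to a leaf changes slope and secant by at most [1 / D] each, so over [|x| <= 3]
    the line stays in the strip of half-width [4 / D] about the leaf line; [g a] is the shift of
    that leaf. *)
Lemma kakeya_slopes (R : realType) (e d : R) : 0 < e -> 0 < d ->
  exists (E : set (R * R)) (g : R -> R),
    [/\ measurable E, forall p, E p -> `|p.1| <= 3,
        forall x, interval_cover [set y | E (x, y)] e,
        forall a, `|g a| <= d
      & forall (a x y : R) (b : bool), `|a| <= 1 -> `|x| <= 3 ->
          y = a * x + (-1) ^+ b * secant a + g a -> E (x, y)].
Proof.
move=> e0 d0.
(* Each of the two signs costs [24 / p]. *)
pose p := (Num.truncn (48 / e)).+1.
pose N := (8 * p)%N.
(* The last factor ensures [4 / M <= d], the bound on the shifts. *)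
pose M := (p * N ^ N.+1 * (Num.truncn (4 / d)).+1)%N.
pose D := (M * N ^ N.+1)%N.
have p0 : (0 < p)%N by [].
have N0 : (0 < N)%N by rewrite muln_gt0.
have pM : (p * N ^ N.+1 <= M)%N by rewrite leq_pmulr.
have M0 : (0 < M)%N by apply: leq_trans pM; rewrite muln_gt0 p0 expn_gt0 N0.
have D0 : (0 < D)%N by rewrite muln_gt0 M0 expn_gt0 N0.
have pr : 0 < p%:R :> R by rewrite ltr0n.
have Mr : 0 < M%:R :> R by rewrite ltr0n.
have Dr : 0 < D%:R :> R by rewrite ltr0n.
have pe : 24 / p%:R + 24 / p%:R <= e.
  rewrite -mulrDl -natrD ler_pdivrMr // mulrC -ler_pdivrMr //.
  exact/ltW/truncnS_gt.
have Md : 4 / M%:R <= d.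
  rewrite ler_pdivrMr // mulrC -ler_pdivrMr //.
  apply/ltW/(lt_le_trans (truncnS_gt _)); rewrite ler_nat.
  by rewrite leq_pmull // muln_gt0 expn_gt0 N0.
pose line b x n := @leaf_line R p M b x n.
pose strip b n := [set q : R * R | `|q.2 - line b q.1 n| <= 4 / D%:R].
have mstrip b n : measurable (strip b n).
  rewrite (_ : strip b n = [set q : R * R | `|q.2 - (digit_trunc R p M N.+1 n * q.1
    + ((-1) ^+ b * secant (digit_trunc R p M N.+1 n) + digit_shift R p M n))|
    <= 4 / D%:R]); first exact: measurable_strip.
  by apply/seteqP; split => q; rewrite /strip /line /leaf_line /= addrA.
exists ([set q | `|q.1| <= 3] `&`
  \bigcup_(n < (2 * D).+1) (strip false n `|` strip true n)).
exists (fun a => digit_shift R p M (Num.truncn ((a + 1) * D%:R))).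
split.
- apply: measurableI; last first.
    by apply: bigcup_measurable => n _; apply: measurableU; exact: mstrip.
  have mf : measurable_fun setT (fun q : R * R => `|q.1|).
    by apply: measurableT_comp => //.
  rewrite (_ : [set q | _] = setT `&` (fun q : R * R => `|q.1|) @^-1` `]-oo, 3]).
    by apply: mf => //; exact: measurable_itv.
  by rewrite setTI; apply/seteqP; split => q /=; rewrite in_itv.
- by move=> q [].
- move=> x; have [x3|x3] := leP `|x| 3; last first.
    exists [::]; split => //; last by rewrite big_nil ltW.
    by move=> y [/= ]; rewrite leNgt x3.
  have := interval_cover_setU (leaf_lines_slice_cover p0 pM false x3)
    (leaf_lines_slice_cover p0 pM true x3).
  apply: interval_cover_sub => // y [_ [n /= nD [H|H]]]; [left|right];
    by exists n.
- by move=> a; apply: le_trans (digit_shift_norm R p0 pM _) Md.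
move=> a x y b a1 x3 ->; split; first exact: x3.
have a01 : 0 <= a + 1 /\ a + 1 <= 2 by move: a1; rewrite ler_norml; lra.
have aD0 : 0 <= (a + 1) * D%:R by rewrite mulr_ge0 // a01.1.
set n := Num.truncn ((a + 1) * D%:R).
have /andP[n1 n2] := truncn_itv aD0.
have nD : (n <= 2 * D)%N.
  by rewrite -(ler_nat R) (le_trans n1) // natrM ler_wpM2r // a01.2.
exists n => //.
suff : strip b n (x, a * x + (-1) ^+ b * secant a + digit_shift R p M n).
  by case: b => H; [right|left].
rewrite /strip /line /leaf_line digit_trunc_last -/N -/D /=.
set t := n%:R / D%:R - 1.
have ta : `|a - t| <= D%:R^-1.
  have h1 : n%:R / D%:R <= a + 1 by rewrite ler_pdivrMr.
  have h2 : a + 1 <= n%:R / D%:R + D%:R^-1.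
    by rewrite -{2}[D%:R^-1]mul1r -mulrDl natr1 ler_pdivlMr // ltW.
  by rewrite ler_norml /t; apply/andP; split; lra.
rewrite (_ : _ - _ = (a - t) * x + (-1) ^+ b * (secant a - secant t));
  last by ring.
apply: (le_trans (ler_normD _ _)); rewrite normrM normrMsign.
have := secant_lipschitz a t => H.
have H3 : `|a - t| * `|x| <= D%:R^-1 * 3 by rewrite ler_pM.
by rewrite -[4 / _]mulrC; lra.
Qed.

(** * From tangent lines to rotated squares *)

(** Undoing the rotation turns each side into a linear equation with coefficients [cos t] and
    [sin t], up to sign. Dividing by the larger one gives [a = tan t] or [a = - cot t], and its
    inverse is a secant up to sign. *)
Lemma Ntheta_slope (R : realType) (t : R) : exists2 a : R, `|a| <= 1 &
  forall p, Ntheta t p -> [/\ `|p.1| <= 2, `|p.2| <= 2 &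
    exists b : bool, p.2 = a * p.1 + (-1) ^+ b * secant a
                  \/ p.1 = - a * p.2 + (-1) ^+ b * secant a].
Proof.
have cs := cos2Dsin2 t.
have bnd (q : R * R) : Num.max `|q.1| `|q.2| = 1 -> `|q.1| <= 1 /\ `|q.2| <= 1.
  by move=> <-; rewrite !le_max !lexx orbT.
have c1 : `|cos t| <= 1 by rewrite ler_norml cos_geN1 cos_le1.
have s1 : `|sin t| <= 1 by rewrite ler_norml sin_geN1 sin_le1.
have bnd2 p : Ntheta t p -> `|p.1| <= 2 /\ `|p.2| <= 2.
  move=> [q /bnd[q1 q2] <-]; rewrite /rot /=; split.
    apply: (le_trans (ler_normB _ _)); rewrite !normrM.
    by rewrite -[2]/(1 + 1) lerD // mulr_ile1.
  apply: (le_trans (ler_normD _ _)); rewrite !normrM.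
  by rewrite -[2]/(1 + 1) lerD // mulr_ile1.
have sgnE (u : R) : exists b : bool, u = (-1) ^+ b * `|u|.
  exists (u < 0); have [u0|u0] := ltP u 0; last by rewrite ger0_norm // mul1r.
  by rewrite ltr0_norm // mulN1r opprK.
have sgn (u : R) : `|u| = 1 -> exists b : bool, u = (-1) ^+ b.
  by have [b bE] := sgnE u => u1; exists b; rewrite bE u1 mulr1.
have side p : Ntheta t p ->
    (exists b : bool, cos t * p.2 - sin t * p.1 = (-1) ^+ b) \/
    (exists b : bool, cos t * p.1 + sin t * p.2 = (-1) ^+ b).
  move=> [q /= q1 <-]; rewrite /rot /=.
  have -> : cos t * (sin t * q.1 + cos t * q.2)
            - sin t * (cos t * q.1 - sin t * q.2) = q.2.
    by rewrite -[RHS]mul1r -cs; ring.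
  have -> : cos t * (cos t * q.1 - sin t * q.2)
            + sin t * (sin t * q.1 + cos t * q.2) = q.1.
    by rewrite -[RHS]mul1r -cs; ring.
  by move: q1; rewrite /square_perimeter /= maxEle; case: ifP => _ H; [left|right]; exact: sgn.
have secE (c s : R) : c ^+ 2 + s ^+ 2 = 1 -> c != 0 ->
    exists b : bool, c^-1 = (-1) ^+ b * secant (s / c).
  move=> cs1 c0; have [b cb] := sgnE c.
  exists b.
  have -> : secant (s / c) = `|c|^-1.
    rewrite /secant; have -> : 1 + (s / c) ^+ 2 = (c^-1) ^+ 2.
      have c2 : c ^+ 2 != 0 by rewrite expf_neq0.
      apply: (mulIf c2).
      by rewrite mulrDl mul1r expr_div_n divfK // exprVn mulVf.
    by rewrite sqrtr_sqr normfV.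
  by rewrite {1}cb invfM invr_sign.
have [sc|cs'] := leP `|sin t| `|cos t|.
  have c0 : cos t != 0.
    apply/eqP => c0; move: sc cs; rewrite c0 normr0 normr_le0 => /eqP ->.
    by rewrite expr0n /= addr0 => /eqP; rewrite eq_sym oner_eq0.
  exists (sin t / cos t).
    by rewrite normrM normfV ler_pdivrMr ?normr_gt0 // mul1r.
  move=> p Np; have [? ?] := bnd2 p Np; split => //.
  have [b' b'E] := secE _ _ cs c0.
  have [[b bE]|[b bE]] := side p Np; exists (b (+) b').
    left; rewrite signr_addb -(mulrA ((-1) ^+ b)) -b'E -bE; field; exact: c0.
  right; rewrite signr_addb -(mulrA ((-1) ^+ b)) -b'E -bE; field; exact: c0.
have s0 : sin t != 0.
  by rewrite -normr_gt0; apply: le_lt_trans cs'.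
exists (- cos t / sin t).
  by rewrite normrM normrN normfV ler_pdivrMr ?normr_gt0 // mul1r ltW.
move=> p Np; have [? ?] := bnd2 p Np; split => //.
have [b' b'E] : exists b : bool, (sin t)^-1 = (-1) ^+ b * secant (- cos t / sin t).
  by apply: secE => //; rewrite sqrrN addrC.
have [[b bE]|[b bE]] := side p Np.
  exists (~~ b (+) b'); right.
  rewrite signr_addb -(mulrA ((-1) ^+ ~~ b)) -b'E signrN -bE; field; exact: s0.
exists (b (+) b'); left.
rewrite signr_addb -(mulrA ((-1) ^+ b)) -b'E -bE; field; exact: s0.
Qed.

Lemma kakeya_squares (R : realType) (z0 : R * R) (e d : R) : 0 < e -> 0 < d ->
  exists F : set (R * R), [/\ measurable F, (leb2 F <= e%:E)%E &
    forall t, exists z : R * R,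
      [/\ `|z.1 - z0.1| <= d, `|z.2 - z0.2| <= d &
          forall p, Ntheta t p -> F (z.1 + p.1, z.2 + p.2)]].
Proof.
(* With [d <= 1], a side with coordinates bounded by 2 stays in the range [|x| <= 3] after the
   shift. *)
move=> e0 d0; wlog d1 : d d0 / d <= 1.
  move=> W; have d'0 : 0 < Num.min d 1 by rewrite lt_min d0 ltr01.
  have d'1 : Num.min d 1 <= 1 by rewrite ge_min lexx orbT.
  have [F [mF Fe FN]] := W _ d'0 d'1.
  exists F; split => // t; have [z [z1 z2 zF]] := FN t.
  exists z; split => //.
    by move: z1; rewrite le_min => /andP[].
  by move: z2; rewrite le_min => /andP[].
(* [E] and its mirror image each lie over an interval of length 6. Halving [d] leaves room for the
   sum of two values of [g] in the centre. *)
have e12 : 0 < e / 12 by rewrite divr_gt0.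
have d2 : 0 < d / 2 by rewrite divr_gt0.
have [E [g [mE E3 Ecov gd Eline]]] := kakeya_slopes e12 d2.
pose F1 := [set p : R * R | E (p.1 - z0.1, p.2 - z0.2)].
pose F2 := [set p : R * R | E (p.2 - z0.2, p.1 - z0.1)].
have mF1 : measurable F1.
  have mf : measurable_fun setT (fun p : R * R => (p.1 - z0.1, p.2 - z0.2)).
    by apply: measurable_fun_pair; apply: measurable_funB.
  by rewrite -[F1]setTI; apply: mf.
have mF2 : measurable F2.
  have mf : measurable_fun setT (fun p : R * R => (p.2 - z0.2, p.1 - z0.1)).
    by apply: measurable_fun_pair; apply: measurable_funB.
  by rewrite -[F2]setTI; apply: mf.
exists (F1 `|` F2); split; first exact: measurableU.
  apply: (le_trans (measureU2 (lebesgue_measure \x lebesgue_measure)%E mF1 mF2)).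
  have -> : e = e / 12 * ((z0.1 + 3) - (z0.1 - 3))
              + e / 12 * ((z0.2 + 3) - (z0.2 - 3)) by field.
  rewrite EFinD; apply: leeD.
    apply: leb2_le_xsection => //; [exact: ltW | lra | |].
      by move=> p /E3 /=; rewrite ler_norml => /andP[? ?]; apply/andP; split; lra.
    by move=> x; exact: (interval_cover_shift z0.2 (Ecov (x - z0.1))).
  apply: leb2_le_ysection => //; [exact: ltW | lra | |].
    by move=> p /E3 /=; rewrite ler_norml => /andP[? ?]; apply/andP; split; lra.
  by move=> y; exact: (interval_cover_shift z0.1 (Ecov (y - z0.2))).
move=> t; have [a a1 aN] := Ntheta_slope t.
have q0 : 0 < 1 + a ^+ 2 by rewrite ltr_pwDl // sqr_ge0.
(* [w] is chosen so that [w2 - a * w1 = g a] and [w1 + a * w2 = g (- a)]. *)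
pose w1 := (g (- a) - a * g a) / (1 + a ^+ 2).
pose w2 := (g a + a * g (- a)) / (1 + a ^+ 2).
have wd (u v : R) : `|u| <= d / 2 -> `|v| <= d / 2 ->
    `|(u + a * v) / (1 + a ^+ 2)| <= d.
  move=> ud vd; rewrite normrM normfV (gtr0_norm q0) ler_pdivrMr //.
  apply: (le_trans (ler_normD _ _)); rewrite normrM.
  have : `|a| * `|v| <= 1 * (d / 2) by rewrite ler_pM.
  have : d * 1 <= d * (1 + a ^+ 2) by rewrite ler_wpM2l ?(ltW d0) // lerDl sqr_ge0.
  lra.
have w1d : `|w1| <= d by rewrite /w1 -mulrN; apply: wd; rewrite ?normrN.
have w2d : `|w2| <= d by apply: wd.
exists (z0.1 + w1, z0.2 + w2); rewrite /= ![_ + w1]addrC ![_ + w2]addrC !addrK.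
split => // p /aN [p1 p2 [b [pE|pE]]]; [left|right]; rewrite /F1 /F2 /=.
  apply: (Eline a _ _ b) => //.
    rewrite (_ : _ - _ = w1 + p.1); last by ring.
    by apply: (le_trans (ler_normD _ _)); lra.
  by rewrite pE /w1 /w2; field; rewrite lt0r_neq0.
apply: (Eline (- a) _ _ b); rewrite ?normrN //.
  rewrite (_ : _ - _ = w2 + p.2); last by ring.
  by apply: (le_trans (ler_normD _ _)); lra.
rewrite (_ : secant (- a) = secant a); last by rewrite /secant sqrrN.
by rewrite pE /w1 /w2; field; rewrite lt0r_neq0.
Qed.

(** * The exceptional set *)

(** Used to pass from [z = x + y] to [x] lying on the copy of [Ntheta t] centred at [z]. *)
Lemma Ntheta_opp (R : realType) (t : R) (p : R * R) :
  Ntheta t p -> Ntheta t (- p.1, - p.2).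
Proof.
move=> [q q1 <-]; exists (- q.1, - q.2).
  by move: q1; rewrite /square_perimeter /= !normrN.
by rewrite /rot; congr (_, _) => /=; ring.
Qed.

Lemma dense_squares (R : realType) (e : R) : 0 < e ->
  exists U : set (R * R), [/\ measurable U, (leb2 U <= e%:E)%E &
    forall (t : R) (z0 : R * R) (r : R), 0 < r -> exists z : R * R,
      [/\ `|z.1 - z0.1| < r, `|z.2 - z0.2| < r &
          forall p, Ntheta t p -> U (z.1 + p.1, z.2 + p.2)]].
Proof.
move=> e0.
pose en n : R := e / (2 ^ n.+1)%:R.
have en0 n : 0 < en n by rewrite divr_gt0 // ltr0n expn_gt0.
(* Enumerates rational centres with tolerances [1 / m.+1]; numbers that code nothing repeat the
   triple of zeros. *)
pose ix n : rat * rat * nat := odflt (0, 0, 0%N) (unpickle n).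
have ex n : exists F : set (R * R), [/\ measurable F, (leb2 F <= (en n)%:E)%E &
    forall t, exists z : R * R,
      [/\ `|z.1 - ratr (ix n).1.1| <= (ix n).2.+1%:R^-1,
          `|z.2 - ratr (ix n).1.2| <= (ix n).2.+1%:R^-1 &
          forall p, Ntheta t p -> F (z.1 + p.1, z.2 + p.2)]].
  by apply: (kakeya_squares (ratr (ix n).1.1, ratr (ix n).1.2)).
have [F HF] := choice ex.
have mF n : measurable (F n) by have [] := HF n.
have mU : measurable (\bigcup_n F n) by exact: bigcup_measurable.
exists (\bigcup_n F n); split => //.
  pose mu := (@lebesgue_measure R \x @lebesgue_measure R)%E.
  apply: (@le_trans _ _ (\sum_(0 <= n <oo) mu (F n))%E).
    exact: (measure_sigma_subadditive mu).
  apply: (@le_trans _ _ (\sum_(0 <= n <oo) (0 + (en n)%:E))%E).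
    by apply: lee_nneseries => // n _; rewrite add0e; have [] := HF n.
  apply: (le_trans (epsilon_trick _ _ (ltW e0))) => //.
  by rewrite eseries0 // add0e.
move=> t z0 r r0.
have r2 : 0 < r / 2 by rewrite divr_gt0.
have near_rat (x : R) : exists q : rat, `|ratr q - x| < r / 2.
  have [q] : exists q, ratr q \in `]x - r / 2, x + r / 2[.
    by apply: rat_in_itvoo; lra.
  by rewrite in_itv /= -ltr_distlC distrC => qx; exists q.
have [q1 q1E] := near_rat z0.1; have [q2 q2E] := near_rat z0.2.
(* Half of [r] pays for the rational approximation of [z0], half for the displacement of the
   centre. *)
pose m := Num.truncn (r / 2)^-1.
have mr : m.+1%:R^-1 < r / 2.
  by rewrite -[ltRHS]invrK ltf_pV2 ?posrE ?invr_gt0 // truncnS_gt.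
have ixE : ix (pickle (q1, q2, m)) = (q1, q2, m) by rewrite /ix pickleK.
have [_ _ /(_ t)[z]] := HF (pickle (q1, q2, m)).
rewrite ixE /= => -[z1 z2 zF]; exists z; split.
- rewrite (_ : z.1 - z0.1 = (z.1 - ratr q1) + (ratr q1 - z0.1)); last by ring.
  rewrite [r]splitr (le_lt_trans (ler_normD _ _)) // ltrD //.
  exact: le_lt_trans mr.
- rewrite (_ : z.2 - z0.2 = (z.2 - ratr q2) + (ratr q2 - z0.2)); last by ring.
  rewrite [r]splitr (le_lt_trans (ler_normD _ _)) // ltrD //.
  exact: le_lt_trans mr.
- by move=> p /zF ?; exists (pickle (q1, q2, m)).
Qed.

Theorem mainTheorem12 (R : realType) :
  exists A : set (R * R),
    measurable A /\ (0 < leb2 A)%E /\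
    forall t : R, 0 <= t < pi ->
      interior (minkowski_sum A (Ntheta t)) = set0.
Proof.
(* Any bound below 1, the area of the unit square, leaves positive measure after removing [U]. *)
have [U [mU Ue Udense]] := @dense_squares R (1 / 2) ltac:(lra).
pose B : set (R * R) := `[0, 1]%classic `*` `[0, 1]%classic.
have mB : measurable B by apply: measurableX; exact: measurable_itv.
have mA : measurable (B `\` U) by exact: measurableD.
exists (B `\` U); split => //; split.
  pose mu := (@lebesgue_measure R \x @lebesgue_measure R)%E.
  have B1 : leb2 B = 1%:E.
    have l1 : lebesgue_measure (`[0, 1]%classic : set R) = 1%:E.
      by rewrite lebesgue_measure_itv /= lte_fin ltr01 oppr0 adde0.
    rewrite /leb2 [LHS]product_measure1E //.
    by rewrite -[RHS]mule1 -{1 2}l1.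
  rewrite lt0e measure_ge0 andbT; apply/eqP => A0.
  have : (leb2 B <= leb2 (B `\` U) + leb2 U)%E.
    apply: (@le_trans _ _ (leb2 (B `\` U `|` U))).
      apply: (le_measure mu); rewrite ?inE //; first exact: measurableU.
      by move=> p Bp; have [Up|nUp] := pselect (U p); [right|left].
    exact: (measureU2 mu mA mU).
  rewrite A0 add0e B1 => /le_trans/(_ Ue); rewrite lee_fin; lra.
(* A ball inside the sum would contain a centre [z] whose copy of [Ntheta t] lies in [U]; writing
   [z = x + y] then puts [x] in [U]. *)
move=> t _; apply/seteqP; split => // z0 /nbhs_ballP[r /= r0 Sr].
have [z [z1 z2 zU]] := Udense t z0 r r0.
have /Sr [x [y [[_ nUx] [Ny zE]]]] : ball z0 r z.
  by split; rewrite /ball /= distrC.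
apply: nUx.
suff -> : x = (z.1 + - y.1, z.2 + - y.2) by apply: (zU (_, _)); exact: Ntheta_opp.
by rewrite zE /= !addrK; case: (x).
Qed.
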